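(* Consider the DAE system $\dot{\mathbf{x}} = f(\mathbf{x},\mathbf{y})$, $0 = g(\mathbf{x},\mathbf{y})$, with $\mathbf{x}\in\mathbb{R}^n$, $\mathbf{y}\in\mathbb{R}^m$, and its Jacobian blocks $A=\partial f/\partial\mathbf{x}$, $B=\partial f/\partial\mathbf{y}$, $C=\partial g/\partial\mathbf{x}$, $D=\partial g/\partial\mathbf{y}$ at the considered point $(\mathbf{x},\mathbf{y})$. Let $p\in[1,\infty]$, let $P\in\mathbb{R}^{n\times n}$ be symmetric positive definite, and let $R\in\mathbb{R}^{m\times n}$, $Q\in\mathbb{R}^{m\times m}$. Let $F_r = P(A-BD^{-1}C)$ be the generalized reduced Jacobian and $$F=\begin{bmatrix} PA+R^TC & PB+R^TD\\ Q^TC & Q^TD\end{bmatrix}$$ the generalized unreduced Jacobian characterized by $P,Q,R$. If $\mu_p(F)<0$, then $$\mu_p(F_r)\le \mu_p(F).$$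
   Context: The functions $f:\mathbb{R}^n\times\mathbb{R}^m\to\mathbb{R}^n$ and $g:\mathbb{R}^n\times\mathbb{R}^m\to\mathbb{R}^m$ are differentiable, and all Jacobian blocks are evaluated at the point under consideration. The block Jacobian is $J=\begin{bmatrix}A&B\\C&D\end{bmatrix}\in\mathbb{R}^{(n+m)\times(n+m)}$. The matrix $D$ is invertible, so that the reduced Jacobian $J_r=A-BD^{-1}C$ (obtained by eliminating $\delta\mathbf{y}$ from $\delta\dot{\mathbf{x}}=A\,\delta\mathbf{x}+B\,\delta\mathbf{y}$, $0=C\,\delta\mathbf{x}+D\,\delta\mathbf{y}$) is defined. The generalized reduced Jacobian is $F_r=PJ_r$. The generalized unreduced Jacobian is $F=Z^TJ$ with $Z=\begin{bmatrix}P&\mathbf{0}\\R&Q\end{bmatrix}$, where $\mathbf{0}$ is the $n\times m$ zero matrix. For a square real matrix $M$, the logarithmic norm (matrix measure) is $$\mu_p(M)=\lim_{\epsilon\to0^+}\frac{1}{\epsilon}\left(\|I+\epsilon M\|_p-1\right),$$ where $\|\cdot\|_p$ is the matrix norm induced by the vector $p$-norm. In particular $\mu_1(M)=\max_j(m_{jj}+\sum_{i\ne j}|m_{ij}|)$, $\mu_2(M)=\lambda_{\max}((M+M^T)/2)$, $\mu_\infty(M)=\max_i(m_{ii}+\sum_{j\neq i}|m_{ij}|)$. *)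

(* Defs.v *)
From mathcomp Require Import all_boot all_order all_algebra.
From mathcomp Require Import all_classical all_reals all_analysis.

Set Implicit Arguments.
Unset Strict Implicit.
Unset Printing Implicit Defensive.

Import Order.TTheory GRing.Theory Num.Theory.
Import numFieldNormedType.Exports.

Local Open Scope classical_set_scope.
Local Open Scope ring_scope.

(* The exponent p ranges over the extended reals; only 1 <= p is meaningful,
   and the value at -oo is junk. *)
Definition vec_pnorm (K : realType) (p : \bar K) (n : nat) (v : 'cV[K]_n) : K :=
  match p with
  | EFin r => (\sum_(i < n) `|v i 0| `^ r) `^ r^-1
  | +oo%E => \big[Num.max/0]_(i < n) `|v i 0|
  | -oo%E => 0
  end.

Definition mx_pnorm (K : realType) (p : \bar K) (n : nat) (M : 'M[K]_n) : K :=
  sup [set vec_pnorm p (M *m v) / vec_pnorm p v | v in [set v : 'cV[K]_n | v != 0]].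

(* The limit exists whenever 1 <= p and 0 < n.  For n = 0 the difference
   quotient is -1 / e, which has no real limit, so [lim] is a junk value. *)
Definition log_norm (K : realType) (p : \bar K) (n : nat) (M : 'M[K]_n) : K :=
  lim ((e^-1 * (mx_pnorm p (1%:M + e *: M) - 1)) @[e --> (0 : K)^'+]).

(* The library's Jacobian acts on row vectors from the right; the transposes
   below give the usual matrix, with entry (i, j) equal to d h_i / d x_j. *)
Definition jacobian_x (K : realType) (n m k : nat)
    (h : 'rV[K]_n * 'rV[K]_m -> 'rV[K]_k) (x : 'rV[K]_n) (y : 'rV[K]_m) :
    'M[K]_(k, n) :=
  (jacobian (fun u : 'rV[K]_n => h (u, y)) x)^T.

Definition jacobian_y (K : realType) (n m k : nat)
    (h : 'rV[K]_n * 'rV[K]_m -> 'rV[K]_k) (x : 'rV[K]_n) (y : 'rV[K]_m) :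
    'M[K]_(k, m) :=
  (jacobian (fun u : 'rV[K]_m => h (x, u)) y)^T.

Definition sym_posdef (K : realType) (n : nat) (P : 'M[K]_n) : Prop :=
  P^T = P /\ forall v : 'cV[K]_n, v != 0 -> 0 < (v^T *m P *m v) 0 0.

Definition gen_reduced_jacobian (K : realType) (n m : nat) (P : 'M[K]_n)
    (A : 'M[K]_n) (B : 'M[K]_(n, m)) (C : 'M[K]_(m, n)) (D : 'M[K]_m) :
    'M[K]_n :=
  P *m (A - B *m invmx D *m C).

Definition gen_unreduced_jacobian (K : realType) (n m : nat)
    (P : 'M[K]_n) (Q : 'M[K]_m) (R : 'M[K]_(m, n))
    (A : 'M[K]_n) (B : 'M[K]_(n, m)) (C : 'M[K]_(m, n)) (D : 'M[K]_m) :
    'M[K]_(n + m) :=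
  block_mx (P *m A + R^T *m C) (P *m B + R^T *m D)
           (Q^T *m C)          (Q^T *m D).

Lemma gen_unreduced_jacobianE (K : realType) (n m : nat)
    (P : 'M[K]_n) (Q : 'M[K]_m) (R : 'M[K]_(m, n))
    (A : 'M[K]_n) (B : 'M[K]_(n, m)) (C : 'M[K]_(m, n)) (D : 'M[K]_m) :
  P^T = P ->
  gen_unreduced_jacobian P Q R A B C D =
  (block_mx P 0 R Q)^T *m block_mx A B C D.
Proof.
by move=> PT; rewrite tr_block_mx mulmx_block PT trmx0 !mul0mx !add0r.
Qed.

(* Main.v *)
(* With w = - D^-1 C u one has F (u, w) = (Fr u, 0), hence
   (I + e F) (u, w) = ((I + e Fr) u, w).  Since mu_p(F) < 0, I + e F is a strict
   contraction for small e > 0; as it leaves the second component w unchanged,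
   it must contract the first one at the same rate, so that
   |I + e Fr| <= |I + e F|.  The difference quotients defining mu_p are
   nondecreasing in e, by convexity of the norm, and bounded below, so both
   limits exist and the inequality passes to the limit. *)
Require Import Defs.
From mathcomp Require Import all_boot all_order all_algebra.
From mathcomp Require Import all_classical all_reals all_analysis.
From mathcomp Require Import lra.
Import Order.TTheory GRing.Theory Num.Theory.
Import numFieldNormedType.Exports.
Local Open Scope ring_scope.

(** * Vector p-norms *)

Lemma vec_pnorm_ge0 (K : realType) (p : \bar K) (n : nat) (v : 'cV[K]_n) :
  0 <= vec_pnorm p v.
Proof.
case: p => [r| |] //=; first exact: powR_ge0.
by elim/big_ind: _ => // x y x0 y0; rewrite le_max x0.
Qed.

Lemma vec_pnorm_powR (K : realType) (r : K) (n : nat) (v : 'cV[K]_n) :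
  1 <= r -> vec_pnorm r%:E v `^ r = \sum_(i < n) `|v i 0| `^ r.
Proof.
move=> r1; have r0 : 0 < r by apply: lt_le_trans r1.
rewrite /vec_pnorm -powRrM mulVf ?gt_eqF// powRr1//.
by apply: sumr_ge0 => i _; exact: powR_ge0.
Qed.

Lemma ler_powR2 (K : realType) (r a b : K) : 0 < r -> 0 <= a -> 0 <= b ->
  (a `^ r <= b `^ r) = (a <= b).
Proof.
move=> r0 a0 b0; apply/idP/idP => h; last first.
  by apply: ge0_ler_powR; rewrite ?nnegrE// ltW.
rewrite leNgt; apply/negP => ab; move: h; apply/negP; rewrite -ltNge.
exact: gt0_ltr_powR.
Qed.

Lemma vec_pnorm_leP (K : realType) (r : K) (n : nat) (v : 'cV[K]_n) (a : K) :
  1 <= r -> 0 <= a ->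
  (vec_pnorm r%:E v <= a) = (\sum_(i < n) `|v i 0| `^ r <= a `^ r).
Proof.
move=> r1 a0; rewrite -(vec_pnorm_powR _ _ _ _ r1) ler_powR2 ?vec_pnorm_ge0//.
exact: lt_le_trans r1.
Qed.

Lemma vec_pnorm_oo_leP (K : realType) (n : nat) (v : 'cV[K]_n) (a : K) :
  0 <= a -> reflect (forall i, `|v i 0| <= a) (vec_pnorm +oo%E v <= a).
Proof.
move=> a0; apply: (iffP idP) => [h i|h].
  by apply: le_trans h; exact: (le_bigmax_cond _ (fun i => `|v i 0|)).
exact: bigmax_le.
Qed.

Lemma ler_coord_vec_pnorm (K : realType) (p : \bar K) (n : nat)
    (v : 'cV[K]_n) (i : 'I_n) : (1 <= p)%E -> `|v i 0| <= vec_pnorm p v.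
Proof.
have N0 := vec_pnorm_ge0 K p n v.
case: p N0 => [r| |] // N0; last first.
  by move=> _; exact/vec_pnorm_oo_leP.
rewrite lee_fin => r1; have r0 : 0 < r by apply: lt_le_trans r1.
rewrite -(ler_powR2 _ _ _ _ r0)// vec_pnorm_powR// (bigD1 i)//= lerDl.
by apply: sumr_ge0 => j _; exact: powR_ge0.
Qed.

Lemma vec_pnorm_gt0 (K : realType) (p : \bar K) (n : nat) (v : 'cV[K]_n) :
  (1 <= p)%E -> v != 0 -> 0 < vec_pnorm p v.
Proof.
move=> p1; apply: contra_neqT; rewrite -leNgt => h; apply/matrixP => i j.
rewrite ord1 mxE; apply/eqP; rewrite -normr_le0.
exact: le_trans (ler_coord_vec_pnorm _ _ _ v i p1) h.
Qed.

Lemma vec_pnorm0 (K : realType) (p : \bar K) (n : nat) :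
  (1 <= p)%E -> vec_pnorm p (0 : 'cV[K]_n) = 0.
Proof.
move=> p1; apply/le_anti; rewrite vec_pnorm_ge0 andbT.
case: p p1 => [r| |] //; last first.
  by move=> _; apply/vec_pnorm_oo_leP => // i; rewrite mxE normr0.
rewrite lee_fin => r1; have r0 : r != 0 by rewrite gt_eqF// (lt_le_trans _ r1).
by rewrite vec_pnorm_leP// big1 ?powR0// => i _; rewrite mxE normr0 powR0.
Qed.

Lemma vec_pnormZ_le (K : realType) (p : \bar K) (n : nat) (a : K)
    (v : 'cV[K]_n) :
  (1 <= p)%E -> vec_pnorm p (a *: v) <= `|a| * vec_pnorm p v.
Proof.
have N0 := vec_pnorm_ge0 K p n v.
case: p N0 => [r| |] // N0; last first.
  move=> _; apply/vec_pnorm_oo_leP => [|i]; first by rewrite mulr_ge0.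
  by rewrite mxE normrM ler_wpM2l// (ler_coord_vec_pnorm _ +oo%E) ?leey.
rewrite lee_fin => r1; rewrite vec_pnorm_leP ?mulr_ge0// powRM//.
rewrite vec_pnorm_powR//.
under eq_bigr do rewrite mxE normrM powRM//.
by rewrite -mulr_sumr.
Qed.

(* Minkowski's inequality is the convexity of [t |-> t^r] applied to the
   normalized vectors, with weights [|u| / (|u| + |v|)]
   and [|v| / (|u| + |v|)]. *)
Lemma ler_vec_pnormD (K : realType) (p : \bar K) (n : nat) (u v : 'cV[K]_n) :
  (1 <= p)%E -> vec_pnorm p (u + v) <= vec_pnorm p u + vec_pnorm p v.
Proof.
move=> p1; have [->|u0] := eqVneq u 0; first by rewrite vec_pnorm0 ?add0r.
have [->|v0] := eqVneq v 0; first by rewrite vec_pnorm0 ?addr0.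
move: (vec_pnorm_gt0 _ _ _ _ p1 u0) (vec_pnorm_gt0 _ _ _ _ p1 v0).
case: p p1 => [r| |] //; last first.
  move=> p1 a0 b0; apply/vec_pnorm_oo_leP => [|i]; first by rewrite ltW ?addr_gt0.
  by rewrite mxE (le_trans (ler_normD _ _))// lerD// ?(ler_coord_vec_pnorm _ +oo%E) ?leey//.
rewrite lee_fin => r1.
have := vec_pnorm_powR _ _ _ u r1; have := vec_pnorm_powR _ _ _ v r1.
rewrite vec_pnorm_leP// ?addr_ge0 ?vec_pnorm_ge0//.
move: (vec_pnorm _ u) (vec_pnorm _ v) => a b hb ha a0 b0.
have ab0 : 0 < a + b by exact: addr_gt0.
pose t := a / (a + b).
have t0 : 0 <= t by rewrite divr_ge0 // ltW.
have t1 : t <= 1 by rewrite ler_pdivrMr// mul1r lerDl ltW.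
have tE : (a + b) * t = a by rewrite mulrC divfK ?gt_eqF.
have t'E : (a + b) * (1 - t) = b by rewrite mulrBr tE mulr1 addrAC subrr add0r.
clearbody t.
have ai0 : 0 <= a^-1 by rewrite invr_ge0 ltW.
have bi0 : 0 <= b^-1 by rewrite invr_ge0 ltW.
have aw := ltW a0; have bw := ltW b0.
(* Keeping the powers of [a^-1] and [b^-1] as separate factors lets the sum over coordinates turn
   the powers of [x] and [y] into [a]^ r[and]b [^ r]; both quotients then become 1 and the weights
   add up to 1. *)
have key (x y : K) : 0 <= x -> 0 <= y ->
    (x + y) `^ r <= (a + b) `^ r *
      (t * (x `^ r * a^-1 `^ r) + (1 - t) * (y `^ r * b^-1 `^ r)).
  move=> x0 y0.
  have xa0 : 0 <= x / a by rewrite mulr_ge0.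
  have yb0 : 0 <= y / b by rewrite mulr_ge0.
  have -> : x + y = (a + b) * (t * (x / a) + (1 - t) * (y / b)).
    rewrite mulrDr !mulrA tE t'E.
    by rewrite [a * x]mulrC [b * y]mulrC !mulfK ?gt_eqF.
  rewrite powRM ?addr_ge0 ?mulr_ge0 ?subr_ge0 ?(ltW ab0)//.
  rewrite ler_wpM2l ?powR_ge0// -!powRM//.
  have := @convex_powR K r r1 (Itv01 t0 t1) (x / a) (y / b).
  by rewrite !inE/= !in_itv/= !andbT => /(_ xa0 yb0); rewrite !convRE.
have uv i : `|(u + v) i 0| `^ r <= (`|u i 0| + `|v i 0|) `^ r.
  apply: ge0_ler_powR; rewrite ?nnegrE ?addr_ge0 ?(le_trans ler01 r1)//.
  by rewrite mxE ler_normD.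
apply: le_trans (ler_sum _ (fun i _ => le_trans (uv i) (key _ _ _ _))) _ => //.
rewrite -mulr_sumr big_split/= -!mulr_sumr -!mulr_suml -ha -hb.
by rewrite -!powRM // !mulfV ?gt_eqF// powR1; lra.
Qed.

(** Write S for the sum. For finite r, S^r = S * S^(r-1), and each |v_i|^r = |v_i| * |v_i|^(r-1) is
    at most |v_i| * S^(r-1). *)
Lemma vec_pnorm_le_sum (K : realType) (p : \bar K) (n : nat) (v : 'cV[K]_n) :
  (1 <= p)%E -> vec_pnorm p v <= \sum_(i < n) `|v i 0|.
Proof.
have S0 : 0 <= \sum_(i < n) `|v i 0| by apply: sumr_ge0.
have vS i : `|v i 0| <= \sum_(j < n) `|v j 0|.
  by rewrite [leRHS](bigD1 i)//= lerDl sumr_ge0.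
case: p => [r| |] //; last by move=> _; exact/vec_pnorm_oo_leP.
rewrite lee_fin => r1; have r0 : 0 < r by apply: lt_le_trans r1.
rewrite vec_pnorm_leP// -(mulr_powRB1 S0 r0) mulr_suml ler_sum// => i _.
rewrite -(mulr_powRB1 (normr_ge0 _) r0) ler_wpM2l//.
by apply: ge0_ler_powR; rewrite ?nnegrE ?subr_ge0.
Qed.

(** A crude operator bound, uniform in p. It makes the supremum in [mx_pnorm] finite and bounds the
    difference quotients from below. *)
Lemma vec_pnorm_mulmx_le (K : realType) (p : \bar K) (m n : nat)
    (M : 'M[K]_(m, n)) (v : 'cV[K]_n) : (1 <= p)%E ->
  vec_pnorm p (M *m v) <= (\sum_(i < m) \sum_(j < n) `|M i j|) * vec_pnorm p v.
Proof.
move=> p1; apply: le_trans (vec_pnorm_le_sum _ _ _ _ p1) _.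
rewrite mulr_suml ler_sum// => i _; rewrite mxE mulr_suml.
apply: le_trans (ler_norm_sum _ _ _) _; apply: ler_sum => j _.
by rewrite normrM ler_wpM2l// ler_coord_vec_pnorm.
Qed.

(** * The induced matrix norm *)

Lemma mx_pnorm_mulmx (K : realType) (p : \bar K) (n : nat) (M : 'M[K]_n)
    (v : 'cV[K]_n) : (1 <= p)%E ->
  vec_pnorm p (M *m v) <= mx_pnorm p M * vec_pnorm p v.
Proof.
move=> p1; have [->|v0] := eqVneq v 0.
  by rewrite mulmx0 vec_pnorm0// mulr0.
rewrite -ler_pdivrMr ?vec_pnorm_gt0//; apply: ub_le_sup; last by exists v.
exists (\sum_(i < n) \sum_(j < n) `|M i j|) => _ [w /= w0 <-].
by rewrite ler_pdivrMr ?vec_pnorm_gt0// vec_pnorm_mulmx_le.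
Qed.

Lemma const_mx1_neq0 (K : realType) (n : nat) : (0 < n)%N ->
  const_mx 1 != 0 :> 'cV[K]_n.
Proof.
case: n => // n _; apply/eqP => /matrixP /(_ 0 0); rewrite !mxE.
by move/eqP; rewrite oner_eq0.
Qed.

(** Positivity of [n] provides a nonzero vector, so the supremum is taken over a nonempty set and is
    not the default value 0. *)
Lemma mx_pnorm_le (K : realType) (p : \bar K) (n : nat) (M : 'M[K]_n) (c : K) :
  (1 <= p)%E -> (0 < n)%N ->
  (forall v, vec_pnorm p (M *m v) <= c * vec_pnorm p v) -> mx_pnorm p M <= c.
Proof.
move=> p1 n0 h; apply: ge_sup.
  pose w : 'cV[K]_n := const_mx 1.
  by exists (vec_pnorm p (M *m w) / vec_pnorm p w), w => //=; exact: const_mx1_neq0.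
by move=> _ [w /= w0 <-]; rewrite ler_pdivrMr ?vec_pnorm_gt0.
Qed.

Lemma mx_pnorm_ge0 (K : realType) (p : \bar K) (n : nat) (M : 'M[K]_n) :
  (1 <= p)%E -> (0 < n)%N -> 0 <= mx_pnorm p M.
Proof.
move=> p1 n0; have := mx_pnorm_mulmx _ p _ M (const_mx 1) p1.
move/(le_trans (vec_pnorm_ge0 _ _ _ _)).
by rewrite pmulr_lge0// vec_pnorm_gt0// const_mx1_neq0.
Qed.

(** * Difference quotients of the logarithmic norm *)

Definition log_quot (K : realType) (p : \bar K) (n : nat) (M : 'M[K]_n)
  (e : K) : K := e^-1 * (mx_pnorm p (1%:M + e *: M) - 1).

(** I + sM is the convex combination of I and I + tM with weights 1 - s/t and s/t, so |I + sM| <= 1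
    - s/t + (s/t) |I + tM|. *)
Lemma log_quot_nondecreasing (K : realType) (p : \bar K) (n : nat)
    (M : 'M[K]_n) (s t : K) : (1 <= p)%E -> (0 < n)%N ->
  0 < s -> s <= t -> log_quot K p n M s <= log_quot K p n M t.
Proof.
move=> p1 n0 s0 st; have t0 : 0 < t by exact: lt_le_trans st.
rewrite /log_quot ler_pdivrMl// mulrA lerBlDr.
have l0 : 0 <= s / t by rewrite divr_ge0// ltW.
have l1 : 0 <= 1 - s / t by rewrite subr_ge0 ler_pdivrMr// mul1r.
apply: mx_pnorm_le => // v.
have -> : (1%:M + s *: M) *m v =
    (1 - s / t) *: v + (s / t) *: ((1%:M + t *: M) *m v).
  rewrite !mulmxDl -!scalemxAl !mul1mx scalerDr scalerA addrA -scalerDl.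
  by rewrite subrK scale1r divfK// gt_eqF.
apply: le_trans (ler_vec_pnormD _ _ _ _ _ p1) _.
apply: le_trans (lerD (vec_pnormZ_le _ _ _ _ _ p1) (vec_pnormZ_le _ _ _ _ _ p1)) _.
rewrite !ger0_norm//.
have := ler_wpM2l l0 (mx_pnorm_mulmx _ p _ (1%:M + t *: M) v p1).
by lra.
Qed.

(** From v = (I + eM)v - eMv, the triangle inequality gives 1 <= |I + eM| + eC, where C is the sum
    of the absolute values of the entries; the all-ones vector serves as v. *)
Lemma log_quot_lbound (K : realType) (p : \bar K) (n : nat)
    (M : 'M[K]_n) (e : K) : (1 <= p)%E -> (0 < n)%N -> 0 < e ->
  - (\sum_(i < n) \sum_(j < n) `|M i j|) <= log_quot K p n M e.
Proof.
move=> p1 n0 e0; rewrite /log_quot ler_pdivlMl//.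
set C := \sum_(i < n) _; pose v : 'cV[K]_n := const_mx 1.
have v0 : 0 < vec_pnorm p v by rewrite vec_pnorm_gt0// const_mx1_neq0.
rewrite -(ler_pM2r v0).
have vE : v = (1%:M + e *: M) *m v + (- e) *: (M *m v).
  by rewrite mulmxDl mul1mx -scalemxAl scaleNr addrK.
have := ler_vec_pnormD _ p _ ((1%:M + e *: M) *m v) ((- e) *: (M *m v)) p1.
rewrite -vE.
have := vec_pnormZ_le _ p _ (- e) (M *m v) p1; rewrite normrN gtr0_norm//.
have := ler_wpM2l (ltW e0) (vec_pnorm_mulmx_le _ p _ _ M v p1).
have := mx_pnorm_mulmx _ p _ (1%:M + e *: M) v p1.
rewrite -/C; lra.
Qed.

Lemma is_cvg_log_quot (K : realType) (p : \bar K) (n : nat) (M : 'M[K]_n) :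
  (1 <= p)%E -> (0 < n)%N ->
  cvg (log_quot K p n M e @[e --> (0 : K)^'+])%classic.
Proof.
move=> p1 n0; apply: nondecreasing_at_right_is_cvgr.
  near=> x => s t /[!in_itv]/= /andP[s0 _] _; exact: log_quot_nondecreasing.
near=> x; exists (- (\sum_(i < n) \sum_(j < n) `|M i j|)) => _ [e /=] + <-.
by rewrite in_itv/= => /andP[e0 _]; exact: log_quot_lbound.
Unshelve. all: by end_near. Qed.

(** * From the unreduced to the reduced Jacobian *)

Lemma vec_pnorm_col_mx_contract (K : realType) (p : \bar K) (n m : nat)
    (u v : 'cV[K]_n) (w : 'cV[K]_m) (c : K) : (1 <= p)%E -> 0 <= c < 1 ->
  vec_pnorm p (col_mx v w) <= c * vec_pnorm p (col_mx u w) ->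
  vec_pnorm p v <= c * vec_pnorm p u.
Proof.
move=> p1 /andP[c0 c1]; have u0 := vec_pnorm_ge0 K p n u.
case: p p1 u0 => [r| |] //.
  rewrite lee_fin => r1 u0; have r0 : 0 < r by apply: lt_le_trans r1.
  have col (z : 'cV[K]_n) : vec_pnorm r%:E (col_mx z w) `^ r =
      vec_pnorm r%:E z `^ r + vec_pnorm r%:E w `^ r.
    rewrite !vec_pnorm_powR// big_split_ord/=.
    by congr (_ + _); apply: eq_bigr => i _; rewrite ?col_mxEu ?col_mxEd.
  have cr1 : c `^ r <= 1.
    have <- : 1 `^ r = 1 :> K by rewrite powR1.
    by rewrite ler_powR2// ltW.
  move: (col u) (col v) (vec_pnorm_ge0 K r%:E _ (col_mx u w)) u0.
  move: (vec_pnorm_ge0 K r%:E _ (col_mx v w)) (vec_pnorm_ge0 K r%:E _ v).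
  move: (vec_pnorm _ (col_mx u w)) (vec_pnorm _ (col_mx v w)).
  move: (vec_pnorm _ u) (vec_pnorm _ v) (vec_pnorm _ w) {col}.
  move=> a b d ad bd bd0 b0 adE bdE ad0 a0 h.
  move: h; rewrite -(ler_powR2 _ r bd) ?mulr_ge0//.
  rewrite -(ler_powR2 _ r b) ?mulr_ge0//.
  rewrite !powRM// adE bdE.
  (* The r-th powers satisfy |v|^r + |w|^r <= c^r |u|^r + c^r |w|^r, and the last term is at most
     |w|^r. *)
  by have := ler_wpM2r (powR_ge0 d r) cr1; lra.
move=> _ u0 h.
set N := vec_pnorm +oo%E (col_mx u w).
have N0 : 0 <= N by exact: vec_pnorm_ge0.
have cN0 : 0 <= c * N by rewrite mulr_ge0.
move/vec_pnorm_oo_leP: h => /(_ cN0) h.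
(* Coordinates of [w] also occur in [col_mx v w], hence are at most [c * N]. *)
have Nmax : N <= Num.max (vec_pnorm +oo%E u) (c * N).
  apply/vec_pnorm_oo_leP => [|i]; first by rewrite le_max u0.
  rewrite le_max; case: (split_ordP i) => j ->.
    by rewrite col_mxEu ler_coord_vec_pnorm// leey.
  by have := h (rshift n j); rewrite !col_mxEd => ->; rewrite orbT.
(* If the maximum is [c * N], then [N <= c * N] with [c < 1] forces [N <= 0]. *)
have Nu : N <= vec_pnorm +oo%E u.
  move: Nmax; rewrite le_max => /orP[//|NcN].
  suff : N <= 0 by move=> /le_trans; exact.
  by rewrite -(pmulr_rle0 _ (_ : 0 < 1 - c)) ?subr_gt0//; lra.
apply/vec_pnorm_oo_leP => [|i]; first by rewrite mulr_ge0.
have := h (lshift m i); rewrite col_mxEu => /le_trans; apply.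
exact: ler_wpM2l.
Qed.

Lemma mx_pnorm_reduced (K : realType) (n m : nat) (p : \bar K)
    (P : 'M[K]_n) (Q : 'M[K]_m) (R : 'M[K]_(m, n))
    (A : 'M[K]_n) (B : 'M[K]_(n, m)) (C : 'M[K]_(m, n)) (D : 'M[K]_m) (e : K) :
  (1 <= p)%E -> (0 < n)%N -> D \in unitmx ->
  let Fe := 1%:M + e *: gen_unreduced_jacobian P Q R A B C D in
  mx_pnorm p Fe < 1 ->
  mx_pnorm p (1%:M + e *: gen_reduced_jacobian P A B C D) <= mx_pnorm p Fe.
Proof.
move=> p1 n0 Du Fe Fe1; apply: mx_pnorm_le => // u.
pose w := - (invmx D *m C *m u).
apply: (vec_pnorm_col_mx_contract _ _ _ _ _ _ w) => //.
  by rewrite Fe1 mx_pnorm_ge0// addn_gt0 n0.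
apply: le_trans (mx_pnorm_mulmx _ _ _ _ _ p1).
rewrite le_eqVlt; apply/orP; left; apply/eqP; congr (vec_pnorm p _).
have Dw : D *m w = - (C *m u) by rewrite mulmxN !mulmxA mulmxV// mul1mx.
rewrite /Fe !mulmxDl !mul1mx -!scalemxAl /gen_unreduced_jacobian mul_block_col scale_col_mx add_col_mx.
(* Replacing [D *m w] by [- (C *m u)] cancels the terms in [R^T] above and in [Q^T] below; what
   remains above is [P] times the Schur complement applied to [u]. *)
rewrite !mulmxDl -!(mulmxA _ D) Dw !mulmxN; congr col_mx.
  congr (_ + _ *: _); rewrite /gen_reduced_jacobian mulmxBr mulmxBl !mulmxA.
  by rewrite addrACA subrr addr0.
by rewrite mulmxA subrr scaler0 addr0.
Qed.

Theorem lemma1 (K : realType) (n m : nat) (hn : (0 < n)%N)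
    (f : 'rV[K]_n * 'rV[K]_m -> 'rV[K]_n)
    (g : 'rV[K]_n * 'rV[K]_m -> 'rV[K]_m)
    (hf : forall z, differentiable f z)
    (hg : forall z, differentiable g z)
    (x : 'rV[K]_n) (y : 'rV[K]_m)
    (p : \bar K) (hp : (1 <= p)%E)
    (P : 'M[K]_n) (Q : 'M[K]_m) (R : 'M[K]_(m, n))
    (hP : sym_posdef P) :
  let A := jacobian_x f x y in
  let B := jacobian_y f x y in
  let C := jacobian_x g x y in
  let D := jacobian_y g x y in
  D \in unitmx ->
  let Fr := gen_reduced_jacobian P A B C D in
  let F := gen_unreduced_jacobian P Q R A B C D in
  log_norm p F < 0 -> log_norm p Fr <= log_norm p F.
Proof.
move=> A B C D Du Fr F F0.
have cF : cvg (log_quot K p _ F e @[e --> (0 : K)^'+])%classic.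
  by apply: is_cvg_log_quot; rewrite // addn_gt0 hn.
have cFr := is_cvg_log_quot K p n Fr hp hn.
(* [log_norm] is by definition the limit of [log_quot], so it suffices to compare the quotients for
   small positive [e]. *)
apply: (ler_lim cFr cF).
(* A negative limit makes the quotient eventually negative, which says that I + eF has norm below
   1. *)
have Fneg := cvgr_lt _ cF _ F0.
near=> e.
have e0 : 0 < e by near: e; exact: nbhs_right_gt.
have : log_quot K p _ F e < 0 by near: e; exact: Fneg.
rewrite /log_quot pmulr_rlt0 ?invr_gt0// subr_lt0 => F1.
by rewrite ler_pM2l ?invr_gt0// lerB// mx_pnorm_reduced.
Unshelve. all: by end_near. Qed.
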